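(* Let $r'$ be a positive integer. The restriction of coefficients morphism $\pi_*:\underline{\mathrm{Dr}\text{-}A'\text{-}\mathrm{Mod}}^{r'}\to\underline{\mathrm{Dr}\text{-}A\text{-}\mathrm{Mod}}^{nr'}$ satisfies the valuative criterion for properness. Explicitly: let $R$ be a valuation ring with fraction field $K$ and let $g:\operatorname{Spec}K\to\operatorname{Spec}R$ be the canonical morphism. Let $(E,\varphi)$ be a Drinfeld-$A$-module of rank $nr'$ and characteristic $c:\operatorname{Spec}R\to\operatorname{Spec}A$ over $\operatorname{Spec}R$, and let $(E',\varphi')$ be a Drinfeld-$A'$-module of rank $r'$ and characteristic $c':\operatorname{Spec}K\to\operatorname{Spec}A'$ over $\operatorname{Spec}K$ such that $\pi\circ c'=c\circ g$ and $g^*(E,\varphi)\cong\pi_*(E',\varphi')$. Then there exist a unique morphism $\tilde c:\operatorname{Spec}R\to\operatorname{Spec}A'$ with $\tilde c\circ g=c'$ and $\pi\circ\tilde c=c$, and a Drinfeld-$A'$-module $(\widetilde E,\widetilde\varphi)$ of rank $r'$ and characteristic $\tilde c$ over $\operatorname{Spec}R$, unique up to isomorphism, such that $g^*(\widetilde E,\widetilde\varphi)\cong(E',\varphi')$ and $\pi_*(\widetilde E,\widetilde\varphi)\cong(E,\varphi)$.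
   Context: Let $\pi:C'\to C$ be a finite morphism of degree $n$ between smooth projective geometrically irreducible curves over the finite field $\mathbb{F}_q$, $\infty\in C$ a closed point with exactly one point $\infty'\in C'$ above it, $A:=\Gamma(C\setminus\{\infty\},\mathcal{O}_C)$, $A':=\Gamma(C'\setminus\{\infty'\},\mathcal{O}_{C'})$; $A'$ is a flat $A$-algebra via $\pi^*:A\to A'$, and $\pi$ also denotes $\operatorname{Spec}A'\to\operatorname{Spec}A$. Put $\deg(\infty):=[\kappa(\infty):\mathbb{F}_q]$ and let $\mathrm{ord}_\infty$ be the normalized valuation on $\mathrm{Frac}(A)$ at $\infty$ (similarly for $A'$, $\infty'$). For an $\mathbb{F}_q$-algebra $B$, $B\{\tau\}$ is the non-commutative polynomial ring with $\tau b=b^q\tau$ for $b\in B$; it is identified with the ring of $\mathbb{F}_q$-linear endomorphisms of $\mathbb{G}_{a,B}$ by sending $\tau$ to the $q$-th power Frobenius. Drinfeld module: let $S$ be an $\mathbb{F}_q$-scheme with a morphism $c:S\to\operatorname{Spec}A$, and $r$ a positive integer. A Drinfeld-$A$-module of rank $r$ and characteristic $c$ over $S$ is a pair $(E,\varphi)$ of a commutative group scheme $E$ over $S$ and a ring homomorphism $\varphi:A\to\operatorname{End}_S(E)$ (endomorphisms of the $S$-group scheme) such that (1) Zariski locally on $S$, $E$ is isomorphic to $\mathbb{G}_{a,S}$ ($\mathbb{F}_q$-linearly, where $\mathbb{F}_q\subset A$ acts on $E$ via $\varphi$ and on $\mathbb{G}_a$ by scalars); (2) if $U=\operatorname{Spec}B\subset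 S$ is affine open and $\psi:E_U\to\mathbb{G}_{a,U}$ is an ($\mathbb{F}_q$-linear) isomorphism of group schemes, then for each $a\in A\setminus\{0\}$ one has $\psi\circ\varphi(a)\circ\psi^{-1}=\sum_{i=0}^{<\infty}\delta_i(a)\tau^i\in B\{\tau\}$ with $\delta_0(a)=c^*(a)$, $\delta_i(a)\in B^\times$ for $i=d(a):=-r\,\mathrm{ord}_\infty(a)\deg(\infty)$, and $\delta_i(a)$ nilpotent for $i>d(a)$. A morphism $(E,\varphi)\to(\widetilde E,\widetilde\varphi)$ is a morphism $\epsilon:E\to\widetilde E$ of $S$-group schemes with $\widetilde\varphi(a)\circ\epsilon=\epsilon\circ\varphi(a)$ for all $a\in A$. Drinfeld-$A'$-modules are defined in the same way with $(C',\infty',A')$. $\underline{\mathrm{Dr}\text{-}A\text{-}\mathrm{Mod}}^{r}$ is the contravariant functor from schemes over $\operatorname{Spec}A$ to sets sending $c:S\to\operatorname{Spec}A$ to the set of isomorphism classes of Drinfeld-$A$-modules of rank $r$ and characteristic $c$ over $S$. If $(E',\varphi')$ is a Drinfeld-$A'$-module of rank $r'$ and characteristic $c'$ over $S$, then $\pi_*(E',\varphi'):=(E',\varphi'\circ\pi^* )$ is a Drinfeld-$A$-module of rank $nr'$ and characteristic $\pi\circ c'$. *)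

(* Defs.v *)
From HB Require Import structures.
From mathcomp Require Import all_boot all_order all_algebra.

Set Implicit Arguments.
Unset Strict Implicit.
Unset Printing Implicit Defensive.

Import Order.TTheory GRing.Theory Num.Theory.
Local Open Scope ring_scope.

(** * Curves, through their function fields

  A smooth projective geometrically irreducible curve over Fq is given by its
  function field: a finitely generated extension F/Fq of transcendence degree 1
  in which Fq is algebraically closed (Fq being perfect, this is geometric
  irreducibility).  Closed points are the discrete valuations of F, finite
  morphisms are the finite extensions of function fields. *)

Definition function_field (Fq : finFieldType) (F : fieldType)
    (k : {rmorphism Fq -> F}) : Prop :=
  (exists t : F, ~ algebraicOver k t /\
     exists (m : nat) (e : 'I_m -> F), forall z : F,
       exists (p : 'I_m -> {poly Fq}) (d : {poly Fq}), d != 0 /\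
         (map_poly k d).[t] * z = \sum_i (map_poly k (p i)).[t] * e i)
  /\ (forall z : F, algebraicOver k z -> exists a : Fq, z = k a).

(** The normalized valuation at a closed point.  The value at 0, conventionally
  infinite, is set to the junk value 0, so that points are equal iff their
  valuations are pointwise equal. *)
Definition place (Fq : finFieldType) (F : fieldType) (k : {rmorphism Fq -> F})
    (v : F -> int) : Prop :=
  [/\ v 0 = 0,
      forall x y, x != 0 -> y != 0 -> v (x * y) = v x + v y,
      forall x y, x != 0 -> y != 0 -> x + y != 0 ->
        Order.min (v x) (v y) <= v (x + y),
      forall a : Fq, v (k a) = 0
    & forall m : int, exists2 x, x != 0 & v x = m].

(** [d] is the dimension over Fq of the residue field of [v]: the residue
  classes of some [e_0, ..., e_{d-1}] in the valuation ring form a basis. *)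
Definition residue_degree (Fq : finFieldType) (F : fieldType)
    (k : {rmorphism Fq -> F}) (v : F -> int) (d : nat) : Prop :=
  exists e : 'I_d -> F, (forall i, 0 <= v (e i)) /\
    forall x : F, 0 <= v x ->
      exists! c : {ffun 'I_d -> Fq},
        let y := x - \sum_i k (c i) * e i in y = 0 \/ 0 < v y.

(** The affine curve [C \ {oo}]: its ring [A], of which the function field of
  [C] is the fraction field, consists of the functions regular at every closed
  point other than [oo]. *)
Record pointed_curve (Fq : finFieldType) := PointedCurve {
  coord :> idomainType;
  cst : {rmorphism Fq -> coord};
  ord_inf : {fraction coord} -> int;
  deg_inf : nat;
  function_fieldP : function_field (@tofrac coord \o cst);
  place_inf : place (@tofrac coord \o cst) ord_inf;
  deg_infP : residue_degree (@tofrac coord \o cst) ord_inf deg_inf;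
  regularP : forall f : {fraction coord},
    (exists a : coord, f = tofrac a) <->
    (forall v, place (@tofrac coord \o cst) v -> ~ v =1 ord_inf -> 0 <= v f)
}.

Arguments ord_inf {Fq} C _ : rename.

(** [e] is the ramification index. *)
Definition lies_above (F F' : fieldType) (i : {rmorphism F -> F'})
    (w : F' -> int) (v : F -> int) : Prop :=
  exists e : nat, (0 < e)%N /\ forall x : F, w (i x) = e%:Z * v x.

Record covering (Fq : finFieldType) (C' C : pointed_curve Fq) (n : nat) :=
  Covering {
  pullF : {rmorphism {fraction C} -> {fraction C'}};
  pull : {rmorphism C -> C'};
  pullFE : forall a : C, pullF (tofrac a) = tofrac (pull a);
  pull_cst : forall x : Fq, pull (cst C x) = cst C' x;
  pull_degree : exists e : 'I_n -> {fraction C'}, forall z : {fraction C'},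
    exists! c : {ffun 'I_n -> {fraction C}}, z = \sum_i pullF (c i) * e i;
  inf_above : lies_above pullF (ord_inf C') (ord_inf C);
  inf_unique : forall w, place (@tofrac C' \o cst C') w ->
    lies_above pullF w (ord_inf C) -> w =1 ord_inf C'
}.

(** * Commutative group schemes, through their functors of points

  An affine base scheme Spec B is a ring [B], and c : S -> Spec A is a ring
  morphism A -> B.  A B-algebra is a ring under [B]. *)

Record algebra (B : comNzRingType) := Algebra {
  alg_ring :> comPzRingType;
  alg_str : {rmorphism B -> alg_ring}
}.

Record algebra_hom (B : comNzRingType) (X Y : algebra B) := AlgebraHom {
  alg_fun :> {rmorphism X -> Y};
  alg_homE : forall b : B, alg_fun (alg_str X b) = alg_str Y b
}.

Definition restrict (B B' : comNzRingType) (h : {rmorphism B -> B'})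
  (X : algebra B') : algebra B := Algebra (alg_str X \o h).

Definition restrict_hom (B B' : comNzRingType) (h : {rmorphism B -> B'})
    (X Y : algebra B') (u : algebra_hom X Y) :
    algebra_hom (restrict h X) (restrict h Y) :=
  @AlgebraHom B (restrict h X) (restrict h Y) u (fun b => alg_homE u (h b)).

(** A pair (E, phi) of a commutative group functor over [B] and a ring
  morphism phi : A -> End(E). *)
Record module_functor (A : comNzRingType) (B : comNzRingType) :=
  ModuleFunctor {
  pts :> algebra B -> zmodType;
  fmap : forall X Y : algebra B, algebra_hom X Y -> {additive pts X -> pts Y};
  fmap_id : forall (X : algebra B) (u : algebra_hom X X),
    u =1 id -> fmap u =1 id;
  fmap_comp : forall (X Y Z : algebra B) (u : algebra_hom X Y)
    (v : algebra_hom Y Z) (w : algebra_hom X Z),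
    w =1 v \o u -> fmap w =1 fmap v \o fmap u;
  act : A -> forall X : algebra B, {additive pts X -> pts X};
  act_nat : forall a (X Y : algebra B) (u : algebra_hom X Y) x,
    fmap u (act a X x) = act a Y (fmap u x);
  act1 : forall X x, act 1 X x = x;
  actD : forall a b X x, act (a + b) X x = act a X x + act b X x;
  actM : forall a b X x, act (a * b) X x = act a X (act b X x)
}.

Arguments fmap {A B} M {X Y} u : rename.
Arguments act {A B} M a X : rename.
Arguments act_nat {A B} M a {X Y} u x : rename.

(** Base change of E along Spec B' -> Spec B is, on points, the restriction of
  the functor to B'-algebras. *)
Definition base_change (A B B' : comNzRingType) (h : {rmorphism B -> B'})
    (M : module_functor A B) : module_functor A B' :=
  @ModuleFunctor A B' (fun X => M (restrict h X))
    (fun X Y u => fmap M (restrict_hom h u))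
    (fun X u hu => @fmap_id _ _ M (restrict h X) (restrict_hom h u) hu)
    (fun X Y Z u v w hw =>
       @fmap_comp _ _ M _ _ _ (restrict_hom h u) (restrict_hom h v)
         (restrict_hom h w) hw)
    (fun a X => act M a (restrict h X))
    (fun a X Y u => @act_nat _ _ M a (restrict h X) (restrict h Y) (restrict_hom h u))
    (fun X => @act1 _ _ M (restrict h X))
    (fun a b X => @actD _ _ M a b (restrict h X))
    (fun a b X => @actM _ _ M a b (restrict h X)).

Lemma push_act1 (A A' B : comNzRingType) (p : {rmorphism A -> A'})
  (M : module_functor A' B) X x : act M (p 1) X x = x.
Proof. by rewrite rmorph1 act1. Qed.

Lemma push_actD (A A' B : comNzRingType) (p : {rmorphism A -> A'})
  (M : module_functor A' B) a b X x :
  act M (p (a + b)) X x = act M (p a) X x + act M (p b) X x.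
Proof. by rewrite rmorphD actD. Qed.

Lemma push_actM (A A' B : comNzRingType) (p : {rmorphism A -> A'})
  (M : module_functor A' B) a b X x :
  act M (p (a * b)) X x = act M (p a) X (act M (p b) X x).
Proof. by rewrite rmorphM actM. Qed.

(** Restriction of coefficients: (E, phi) |-> (E, phi \o p). *)
Definition push (A A' B : comNzRingType) (p : {rmorphism A -> A'})
    (M : module_functor A' B) : module_functor A B :=
  @ModuleFunctor A B M (@fmap _ _ M) (@fmap_id _ _ M) (@fmap_comp _ _ M)
    (fun a => act M (p a)) (fun a => @act_nat _ _ M (p a))
    (@push_act1 _ _ _ p M) (@push_actD _ _ _ p M) (@push_actM _ _ _ p M).

Definition isomorphic (A B : comNzRingType) (M N : module_functor A B) : Prop :=
  exists f : forall X : algebra B, {additive M X -> N X},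
    [/\ forall (X Y : algebra B) (u : algebra_hom X Y) x,
          f Y (fmap M u x) = fmap N u (f X x),
        forall a X x, f X (act M a X x) = act N a X (f X x)
      & forall X, bijective (f X)].

(** E is an affine scheme: some Spec H with a universal point [xi].  A scheme
  over Spec B that is Zariski locally isomorphic to the additive group is
  always affine. *)
Definition representable (A B : comNzRingType) (M : module_functor A B) : Prop :=
  exists (H : algebra B) (xi : M H), forall (X : algebra B) (x : M X),
    exists u : algebra_hom H X,
      fmap M u xi = x /\
      forall v : algebra_hom H X, fmap M v xi = x -> v =1 u.

(** * Affine open subschemes *)

(** [h] induces an isomorphism B_f -> B'_(h f). *)
Definition iso_away (B B' : comNzRingType) (h : {rmorphism B -> B'}) (f : B) :
    Prop :=
  (forall b, h b = 0 -> exists N : nat, f ^+ N * b = 0) /\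
  (forall b', exists (N : nat) (b : B), h f ^+ N * b' = h b).

(** Spec h is an open immersion: Spec B' is covered by the D(h f_i), and each of
  these is mapped isomorphically onto D(f_i). *)
Definition affine_open (B B' : comNzRingType) (h : {rmorphism B -> B'}) : Prop :=
  exists (m : nat) (f : 'I_m -> B) (u : 'I_m -> B'),
    \sum_i u i * h (f i) = 1 /\ forall i, iso_away h (f i).

Definition localization (B B' : comNzRingType) (h : {rmorphism B -> B'}) (f : B) :
    Prop :=
  iso_away h f /\ exists y, h f * y = 1.

(** * Drinfeld modules *)

(** An Fq-linear isomorphism psi : E_U -> G_{a,U} over U = Spec B', given on
  points. *)
Definition trivialization (Fq : finFieldType) (C : pointed_curve Fq)
    (B : comNzRingType) (c : {rmorphism C -> B}) (M : module_functor C B)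
    (B' : comNzRingType) (h : {rmorphism B -> B'})
    (psi : forall X : algebra B', {additive M (restrict h X) -> X}) : Prop :=
  [/\ forall (X Y : algebra B') (u : algebra_hom X Y) x,
        psi Y (fmap M (restrict_hom h u) x) = u (psi X x),
      forall (a : Fq) X x,
        psi X (act M (cst C a) (restrict h X) x) =
          alg_str X (h (c (cst C a))) * psi X x
    & forall X, bijective (psi X)].

(** The endomorphism of G_a defined by the element \sum_i d_i tau^i of B{tau},
  which is represented by its list of coefficients; tau acts as x |-> x ^ #|Fq|. *)
Definition tau_eval (Fq : finFieldType) (B : comNzRingType) (d : {poly B})
    (X : algebra B) (x : X) : X :=
  \sum_(i < size d) alg_str X d`_i * x ^+ (#|Fq| ^ i).

Definition deg_at (Fq : finFieldType) (C : pointed_curve Fq) (r : nat) (a : C) :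
    int :=
  - (r%:Z * ord_inf C (tofrac a) * (deg_inf C)%:Z).

(** [M] is a Drinfeld module of rank [r] and characteristic [c] over Spec B.
  The rings here being nonzero, nilpotent f_i are left out of the covering and
  the empty open subscheme, over which the last condition is void, is ignored. *)
Definition drinfeld (Fq : finFieldType) (C : pointed_curve Fq) (r : nat)
    (B : comNzRingType) (c : {rmorphism C -> B}) (M : module_functor C B) : Prop :=
  [/\ representable M,
      exists (m : nat) (f u : 'I_m -> B), \sum_i u i * f i = 1 /\
        forall i, exists (B' : comNzRingType) (h : {rmorphism B -> B'}),
          localization h (f i) /\ exists psi, @trivialization Fq C B c M B' h psi
    & forall (B' : comNzRingType) (h : {rmorphism B -> B'}), affine_open h ->
      forall psi, @trivialization Fq C B c M B' h psi ->
      forall a : C, a != 0 -> exists d : {poly B'},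
        [/\ forall (X : algebra B') (x : M (restrict h X)),
              psi X (act M a (restrict h X) x) = tau_eval Fq d (psi X x),
            d`_0 = h (c a),
            exists i : nat, i%:Z = deg_at r a /\ exists y, d`_i * y = 1
          & forall i : nat, deg_at r a < i%:Z -> exists N : nat, d`_i ^+ N = 0]].

Definition valuation_ring (R : idomainType) : Prop :=
  forall x : {fraction R}, exists a : R, x = tofrac a \/ x^-1 = tofrac a.

(* Main.v *)
Require Import Defs.
From HB Require Import structures.
From mathcomp Require Import all_boot all_order all_algebra.
From mathcomp Require finfield.
From Stdlib Require Import ClassicalEpsilon IndefiniteDescription.
Import GRing.Theory.
Local Open Scope ring_scope.

Set Implicit Arguments.
Unset Strict Implicit.
Unset Printing Implicit Defensive.

(** Over a local domain a Drinfeld module is the additive group with A acting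
  through some phi : A -> B{tau} whose values have unit leading coefficients.
  Choosing coordinates over K so that phi' extends phi, every phi'(a') commutes
  with phi(a) for a nonconstant a in A.  Comparing coefficients in this
  commutation at the coefficient of phi'(a') with the largest pole shows that
  phi'(a') lies in R{tau}: the leading coefficient of phi(a) is a unit and the
  Frobenius power in phi(a) phi'(a') worsens the pole.  Since F'/F is finite,
  a' divides a nonzero element of A, so the leading coefficient of phi'(a') is a
  unit of R.

  For uniqueness, an isomorphism over K between two such modules over R is a
  scalar b, and comparing leading coefficients at a nonconstant a shows that a
  positive power of b is a unit of R.

  The nonconstant a comes from phi rather than from Riemann-Roch: the elements
  of A generate F, so some a <> 0 in A has nonzero order at infinity, and the
  degree of phi(a) is a nonzero multiple of this order. *)

(** * Fractions, common denominators and integral rings *)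

Lemma fractionP (R : idomainType) (x : {fraction R}) :
  exists a b : R, b != 0 /\ x = tofrac a / tofrac b.
Proof.
elim/quotW: x => r; exists (\n_r), (\d_r); split; first exact: denom_ratioP.
have h : tofrac (\d_r) != 0 :> {fraction R} by rewrite tofrac_eq0 denom_ratioP.
apply: (canRL (mulfK h)); rewrite !piE; apply/eqP.
rewrite FracField.equivf_def.
rewrite /FracField.mulf !numden_Ratio ?mulf_neq0 ?oner_neq0 ?denom_ratioP //.
by rewrite !mulr1 mulrC.
Qed.

Lemma tofrac_inj (R : idomainType) : injective (@tofrac R).
Proof. by move=> a b /eqP; rewrite tofrac_eq => /eqP. Qed.

Lemma poly_common_denominator (R : idomainType) (p : {poly {fraction R}}) :
  exists (d : R) (p0 : {poly R}),
    d != 0 /\ map_poly (@tofrac R) p0 = tofrac d *: p.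
Proof.
elim/poly_ind: p => [|p x [d [p0 [d0 e]]]].
  by exists 1, 0; rewrite oner_neq0 rmorph0 scaler0.
have [a [b [b0 ex]]] := fractionP x.
exists (d * b), ((b *: p0) * 'X + (d * a)%:P); rewrite mulf_neq0 //; split=> //.
rewrite rmorphD rmorphM /= map_polyX map_polyC /= map_polyZ e /= !rmorphM scalerDr.
congr (_ + _); first by rewrite scalerA scalerAl [tofrac b * _]mulrC.
rewrite /=; have -> : tofrac a = tofrac b * x by rewrite ex mulrC divfK ?tofrac_eq0.
by rewrite -mul_polyC /= !polyCM mulrA.
Qed.

(** An equality of structures, so that an integral ring can be replaced by an
  [idomainType] everywhere it occurs. *)
Lemma comNzRing_integral (B : comNzRingType) :
  (forall x y : B, x * y = 0 -> x = 0 \/ y = 0) ->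
  exists D : idomainType, D = B :> comNzRingType.
Proof.
move=> hB.
pose isu (x : B) : bool := excluded_middle_informative (exists y, y * x = 1).
pose inv (x : B) : B := match excluded_middle_informative (exists y, y * x = 1)
  with left h => sval (constructive_indefinite_description _ h) | right _ => x end.
have mulVx : {in isu, left_inverse 1 inv *%R}.
  move=> x; rewrite unfold_in /isu /inv; case: excluded_middle_informative => // h _.
  exact: svalP (constructive_indefinite_description _ h).
have unitPl (x y : B) : y * x = 1 -> isu x.
  by move=> e; rewrite /isu; case: excluded_middle_informative => // -[]; exists y.
have inv_out : {in [predC isu], inv =1 id}.
  by move=> x; rewrite inE unfold_in /isu /inv; case: excluded_middle_informative.
(* [B] is unpacked so that the new structures sit on its own carrier and class; the final equation
   [D = B] then holds by computation. *)
case: B hB @isu @inv mulVx unitPl inv_out => T cl hB isu inv h1 h2 h3.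
pose B := GRing.ComNzRing.Pack cl.
pose U := HB.pack_for GRing.ComUnitRing.type T cl
  (GRing.ComNzRing_hasMulInverse.Build B h1 h2 h3).
have hU : forall x y : U, x * y = 0 -> (x == 0) || (y == 0).
  by move=> x y e; apply/orP; case: (hB x y e) => ->; [left|right].
pose D := HB.pack_for idomainType U
  (GRing.ComUnitRing_isIntegral.Build U hU).
by exists D.
Qed.

(** * The additive group and B{tau} *)

Section Tau.
Variables (Fq : finFieldType) (B : comNzRingType).
Local Notation q := #|Fq|.

Lemma tau_eval_wide (d : {poly B}) (X : algebra B) (x : X) N : (size d <= N)%N ->
  tau_eval Fq d x = \sum_(i < N) alg_str X d`_i * x ^+ (q ^ i).
Proof.
move=> le_dN; rewrite /tau_eval.
rewrite (big_ord_widen N (fun i => alg_str X d`_i * x ^+ (q ^ i))) //.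
rewrite [RHS](bigID (fun i : 'I_N => (i < size d)%N)) /= [X in _ + X]big1 ?addr0 //.
by move=> i; rewrite -leqNgt => le_di; rewrite nth_default // rmorph0 mul0r.
Qed.

Lemma tau_evalD (d e : {poly B}) (X : algebra B) (x : X) :
  tau_eval Fq (d + e) x = tau_eval Fq d x + tau_eval Fq e x.
Proof.
have [ld le] := (leq_maxl (size d) (size e), leq_maxr (size d) (size e)).
rewrite (tau_eval_wide _ ld) (tau_eval_wide _ le).
rewrite (tau_eval_wide _ (size_polyD d e)) -big_split /=.
by apply: eq_bigr => i _; rewrite coefD rmorphD mulrDl.
Qed.

Lemma tau_evalZ b (d : {poly B}) (X : algebra B) (x : X) :
  tau_eval Fq (b *: d) x = alg_str X b * tau_eval Fq d x.
Proof.
rewrite (tau_eval_wide _ (size_scale_leq b d)) big_distrr /=.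
by apply: eq_bigr => i _; rewrite coefZ rmorphM mulrA.
Qed.

Lemma tau_eval0 (X : algebra B) (x : X) : tau_eval Fq 0 x = 0.
Proof. by rewrite /tau_eval size_poly0 big_ord0. Qed.

Lemma tau_evalC b (X : algebra B) (x : X) :
  tau_eval Fq b%:P x = alg_str X b * x.
Proof.
by rewrite (tau_eval_wide _ (size_polyC_leq1 b)) big_ord1 coefC expn0 expr1.
Qed.

Lemma tau_eval_sum I (r : seq I) (F : I -> {poly B}) (X : algebra B) (x : X) :
  tau_eval Fq (\sum_(i <- r) F i) x = \sum_(i <- r) tau_eval Fq (F i) x.
Proof.
elim/big_rec2: _ => [|i y d _ <-]; first exact: tau_eval0.
exact: tau_evalD.
Qed.

Lemma tau_eval_hom (d : {poly B}) (X Y : algebra B) (u : algebra_hom X Y) x :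
  u (tau_eval Fq d x) = tau_eval Fq d (u x).
Proof.
rewrite /tau_eval rmorph_sum; apply: eq_bigr => i _.
by rewrite rmorphM rmorphXn alg_homE.
Qed.

Definition poly_algebra : algebra B := @Algebra B {poly B} (@polyC B).

Lemma q_gt1 : (1 < q)%N.
Proof. exact: card_finNzRing_gt1. Qed.

(** ['X] is the universal point of the additive group, and the exponents q^i are distinct, so the
    value there displays every coefficient of [d]. *)
Lemma coef_tau_evalX (d : {poly B}) i :
  (tau_eval Fq d ('X : poly_algebra) : {poly B})`_(q ^ i) = d`_i.
Proof.
rewrite (tau_eval_wide _ (leq_maxl (size d) i.+1)) coef_sum.
have lti : (i < maxn (size d) i.+1)%N by rewrite leq_max ltnSn orbT.
rewrite (bigD1 (Ordinal lti)) //= coefCM coefXn eqxx mulr1 big1 ?addr0 // => j ji.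
rewrite coefCM coefXn eqn_exp2l ?q_gt1 // [(_ == _)%N]eq_sym.
by rewrite -val_eqE /= in ji; rewrite (negbTE ji) mulr0.
Qed.

Lemma tau_evalX_inj (d e : {poly B}) :
  tau_eval Fq d ('X : poly_algebra) = tau_eval Fq e ('X : poly_algebra) -> d = e.
Proof.
by move=> h; apply/polyP => i; rewrite -coef_tau_evalX h coef_tau_evalX.
Qed.

Definition horner_alg_str (X : algebra B) (x : X) (p : {poly B}) : X :=
  \sum_(i < size p) alg_str X p`_i * x ^+ i.

Section Evaluation.
Variables (X : algebra B) (x : X).
Local Notation ev := (@horner_alg_str X x).

Lemma horner_alg_str_wide (p : {poly B}) N : (size p <= N)%N ->
  ev p = \sum_(i < N) alg_str X p`_i * x ^+ i.
Proof.
move=> le_pN; rewrite /horner_alg_str.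
rewrite (big_ord_widen N (fun i => alg_str X p`_i * x ^+ i)) //.
rewrite [RHS](bigID (fun i : 'I_N => (i < size p)%N)) /= [X in _ + X]big1 ?addr0 //.
by move=> i; rewrite -leqNgt => le_di; rewrite nth_default // rmorph0 mul0r.
Qed.

Lemma horner_alg_strC b : ev b%:P = alg_str X b.
Proof.
by rewrite (@horner_alg_str_wide _ 1) ?size_polyC_leq1 // big_ord1 coefC mulr1.
Qed.

Lemma horner_alg_strZ b p : ev (b *: p) = alg_str X b * ev p.
Proof.
rewrite (horner_alg_str_wide (size_scale_leq b p)) big_distrr /=.
by apply: eq_bigr => i _; rewrite coefZ rmorphM mulrA.
Qed.

Lemma horner_alg_strD p r : ev (p + r) = ev p + ev r.
Proof.
have [lp lr] := (leq_maxl (size p) (size r), leq_maxr (size p) (size r)).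
rewrite (horner_alg_str_wide lp) (horner_alg_str_wide lr).
rewrite (horner_alg_str_wide (size_polyD p r)) -big_split /=.
by apply: eq_bigr => i _; rewrite coefD rmorphD mulrDl.
Qed.

Lemma horner_alg_strMX p : ev (p * 'X) = ev p * x.
Proof.
rewrite (@horner_alg_str_wide (p * 'X) (size p).+1); last first.
  by apply: leq_trans (size_polyMleq _ _) _; rewrite size_polyX addn2.
rewrite big_ord_recl coefMX /= rmorph0 mul0r add0r big_distrl /=.
by apply: eq_bigr => i _; rewrite coefMX /= exprSr mulrA.
Qed.

Lemma horner_alg_strX : ev 'X = x.
Proof. by rewrite -['X]mul1r horner_alg_strMX horner_alg_strC rmorph1 mul1r. Qed.

Lemma horner_alg_strM p r : ev (p * r) = ev p * ev r.
Proof.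
elim/poly_ind: p => [|p b IH].
  by rewrite mul0r /horner_alg_str size_poly0 !big_ord0 mul0r.
rewrite mulrDl mulrAC -[p * r * 'X]/((p * r) * 'X) !horner_alg_strD !horner_alg_strMX IH.
by rewrite mul_polyC horner_alg_strZ horner_alg_strC mulrDl mulrAC.
Qed.

Lemma horner_alg_str_is_zmod_morphism : zmod_morphism ev.
Proof.
by move=> p r; rewrite -[- r]scaleN1r horner_alg_strD horner_alg_strZ rmorphN rmorph1 mulN1r.
Qed.

Lemma horner_alg_str_is_monoid_morphism : monoid_morphism ev.
Proof.
by split=> [|p r]; [rewrite horner_alg_strC rmorph1 | rewrite horner_alg_strM].
Qed.

HB.instance Definition _ :=
  GRing.isZmodMorphism.Build {poly B} X ev horner_alg_str_is_zmod_morphism.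
HB.instance Definition _ :=
  GRing.isMonoidMorphism.Build {poly B} X ev horner_alg_str_is_monoid_morphism.

Definition eval_hom : algebra_hom poly_algebra X :=
  @AlgebraHom B poly_algebra X ev horner_alg_strC.

Lemma eval_homX : eval_hom 'X = x.
Proof. exact: horner_alg_strX. Qed.

Lemma eval_hom_unique (u : algebra_hom poly_algebra X) :
  u 'X = x -> u =1 eval_hom.
Proof.
move=> ux p; elim/poly_ind: p => [|p b IH]; first by rewrite !rmorph0.
rewrite 2!rmorphD 2!rmorphM IH ux eval_homX; congr (_ + _).
by rewrite (alg_homE u b) (alg_homE eval_hom b).
Qed.

End Evaluation.

Lemma eval_hom_comp (p r : {poly B}) : eval_hom (r : poly_algebra) p = p \Po r.
Proof.
rewrite comp_polyE; apply: eq_bigr => i _.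
by rewrite -mul_polyC.
Qed.

End Tau.

(** The middle binomial coefficients are divisible by p. Characteristic p is expressed by
    [p%:R = 0], which also covers the zero ring, a legitimate algebra of points. *)
Lemma exprDn_char (X : comPzRingType) (p e : nat) (x y : X) :
  prime p -> p%:R = 0 :> X -> (x + y) ^+ (p ^ e) = x ^+ (p ^ e) + y ^+ (p ^ e).
Proof.
move=> p_pr p0; elim: e => [|e IH]; first by rewrite !expr1.
rewrite expnSr !exprM IH; move: (x ^+ _) (y ^+ _) => a b.
rewrite exprDn; case: p p_pr p0 {IH} => // p p_pr p0.
rewrite big_ord_recl big_ord_recr /= subn0 subnn bin0 binn !mulr1n mul1r mulr1.
rewrite [X in _ + (X + _)]big1 ?add0r // => i _.
have /dvdnP[m ->] : (p.+1 %| 'C(p.+1, bump 0 i))%N.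
  by apply: prime_dvd_bin => //; rewrite /bump /= add1n ltnS ltn_ord.
by rewrite mulrnA -mulr_natr p0 mulr0.
Qed.

Lemma exprDn_card (Fq : finFieldType) (X : comPzRingType)
    (k : {rmorphism Fq -> X}) i (x y : X) :
  (x + y) ^+ (#|Fq| ^ i) = x ^+ (#|Fq| ^ i) + y ^+ (#|Fq| ^ i).
Proof.
have [p p_pr charFq] := finfield.finPcharP Fq.
rewrite (finfield.card_pprimeChar charFq) -expnM exprDn_char //.
by rewrite -(rmorph_nat k) (pcharf0 charFq) rmorph0.
Qed.

Section SkewMul.
Variables (Fq : finFieldType) (B : comNzRingType).
Local Notation q := #|Fq|.

(** Multiplication in B{tau}. *)
Definition skew_mul (f g : {poly B}) : {poly B} :=
  \sum_(j < size f) f`_j *: ('X^j * map_poly (fun b => b ^+ (q ^ j)) g).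

Lemma expr0q j : 0 ^+ (q ^ j) = 0 :> B.
Proof. by rewrite expr0n expn_eq0 -leqn0 leqNgt (ltnW (q_gt1 Fq)). Qed.

Lemma coef_skew_mul f g m :
  (skew_mul f g)`_m =
  \sum_(j < size f) f`_j * (if (m < j)%N then 0 else g`_(m - j) ^+ (q ^ j)).
Proof.
rewrite coef_sum; apply: eq_bigr => j _.
by rewrite coefZ coefXnM coef_map_id0 ?expr0q.
Qed.

(** The map [k] makes tau^j additive on every algebra, so it can be carried through the sum that
    defines the inner value. *)
Lemma tau_eval_skew_mul (k : {rmorphism Fq -> B}) f g (X : algebra B) (x : X) :
  tau_eval Fq (skew_mul f g) x = tau_eval Fq f (tau_eval Fq g x).
Proof.
rewrite tau_eval_sum; apply: eq_bigr => j _; rewrite tau_evalZ; congr (_ * _).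
have frob : {morph (fun y : X => y ^+ (q ^ j)) : y z / y + z}.
  by move=> y z; apply: (exprDn_card (alg_str X \o k)).
have frob0 : (0 : X) ^+ (q ^ j) = 0.
  by rewrite -(rmorph0 (alg_str X)) -rmorphXn expr0q.
rewrite [in RHS]/tau_eval (big_morph _ frob frob0).
(* Left multiplication by tau^j shifts [g] by j places: j + size g bounds the size, and the first j
   coefficients vanish. *)
rewrite (@tau_eval_wide _ _ _ _ _ (j + size g)); last first.
  apply/leq_sizeP => i le_i; rewrite coefXnM coef_map_id0 ?expr0q //.
  case: ltnP => // le_ji; rewrite nth_default ?expr0q //.
  by rewrite leq_subRL.
rewrite big_split_ord /= big1 ?add0r => [|i _]; last first.
  by rewrite coefXnM ltn_ord rmorph0 mul0r.
apply: eq_bigr => i _; rewrite coefXnM ltnNge leq_addr /= addKn.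
rewrite coef_map_id0 ?expr0q // exprMn -exprM -expnD addnC.
by rewrite rmorphXn.
Qed.

End SkewMul.

Lemma skew_mul_map (Fq : finFieldType) (B B' : idomainType)
    (h : {rmorphism B -> B'}) (f g : {poly B}) : injective h ->
  skew_mul Fq (map_poly h f) (map_poly h g) = map_poly h (skew_mul Fq f g).
Proof.
move=> h_inj; apply/polyP => m.
rewrite coef_map /= !coef_skew_mul size_map_inj_poly ?rmorph0 // rmorph_sum.
apply: eq_bigr => j _; rewrite !coef_map /= rmorphM.
by case: ifP; rewrite ?rmorph0 ?rmorphXn.
Qed.

Lemma coef_skew_mul_top (Fq : finFieldType) (B : comNzRingType) (f g : {poly B}) i j :
  size f = i.+1 -> size g = j.+1 ->
  (skew_mul Fq f g)`_(i + j) = f`_i * g`_j ^+ (#|Fq| ^ i).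
Proof.
move=> sf sg; rewrite coef_skew_mul sf big_ord_recr /= ltnNge leq_addr addKn big1 ?add0r //.
move=> k _; rewrite ltnNge (leq_trans (ltnW (ltn_ord k)) (leq_addr _ _)) /=.
rewrite [g`__]nth_default ?expr0q ?mulr0 // sg.
by rewrite ltn_subRL ltn_add2r.
Qed.

Lemma size_skew_mul_leq (Fq : finFieldType) (B : comNzRingType) (f g : {poly B}) i j :
  size f = i.+1 -> size g = j.+1 -> (size (skew_mul Fq f g) <= (i + j).+1)%N.
Proof.
move=> sf sg; apply/leq_sizeP => m ltm; rewrite coef_skew_mul sf big1 // => k _.
have le_ki : (k <= i)%N by rewrite -ltnS.
rewrite ltnNge (leq_trans le_ki (leq_trans (leq_addr j i) (ltnW ltm))) /=.
rewrite [g`__]nth_default ?expr0q ?mulr0 // sg ltn_subRL.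
by apply: leq_ltn_trans ltm; rewrite leq_add2r.
Qed.

(** * Valuation rings and function fields *)

(** Divisibility is total over a valuation ring, so a finite nonempty family has a member of least
    valuation. This serves both to select the worst pole among coefficients and to make finitely
    generated ideals principal. *)
Lemma divides_all (R : idomainType) (m : nat) (f : 'I_m -> {fraction R}) :
  valuation_ring R -> (0 < m)%N ->
  exists i, forall j, exists a : R, f j = f i * tofrac a.
Proof.
move=> hR m_gt0.
have total (x y : {fraction R}) :
    (exists a : R, y = x * tofrac a) \/ exists a : R, x = y * tofrac a.
  have [->|x0] := eqVneq x 0.
    by right; exists 0; rewrite rmorph0 mulr0.
  have [->|y0] := eqVneq y 0.
    by left; exists 0; rewrite rmorph0 mulr0.
  case: (hR (y / x)) => a [] e; [left|right]; exists a; rewrite -e.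
    by rewrite mulrC divfK.
  by rewrite invf_div mulrC divfK.
suff H (s : seq 'I_m) : s != [::] ->
    exists i, forall j, j \in s -> exists a : R, f j = f i * tofrac a.
  have [|i hi] := H (enum 'I_m); first by rewrite -size_eq0 size_enum_ord -lt0n.
  by exists i => j; apply: hi; rewrite mem_enum.
elim: s => // k [|k' s] IH _.
  by exists k => j; rewrite inE => /eqP ->; exists 1; rewrite rmorph1 mulr1.
have [//|i hi] := IH; case: (total (f k) (f i)) => -[a ea].
  exists k => j; rewrite inE => /predU1P[->|/hi[b eb]].
    by exists 1; rewrite rmorph1 mulr1.
  by exists (a * b); rewrite eb ea rmorphM mulrA.
exists i => j; rewrite inE => /predU1P[->|]; last exact: hi.
by exists a.
Qed.

Lemma poly_lift (R : idomainType) (f : {poly {fraction R}}) :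
  (forall i, exists a : R, f`_i = tofrac a) ->
  exists f0 : {poly R}, f = map_poly (@tofrac R) f0.
Proof.
move=> /functional_choice[F hF]; exists (\poly_(i < size f) F i).
apply/polyP => i; rewrite coef_map coef_poly /=.
by case: ltnP => [_|le_fi]; [rewrite hF | rewrite nth_default ?rmorph0].
Qed.

Lemma skew_commute_integral (Fq : finFieldType) (R : idomainType)
    (f : {poly {fraction R}}) (g : {poly R}) d :
  valuation_ring R -> size g = d.+1 -> (0 < d)%N -> g`_d \is a GRing.unit ->
  skew_mul Fq f (map_poly (@tofrac R) g) = skew_mul Fq (map_poly (@tofrac R) g) f ->
  exists f0 : {poly R}, f = map_poly (@tofrac R) f0.
Proof.
move=> hR sg d_gt0 g_unit fg; set q := #|Fq| in fg.
have [->|f_neq0] := eqVneq f 0; first by exists 0; rewrite rmorph0.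
have [i hi] : exists i, forall j, exists a : R, f`_j = f`_i * tofrac a.
  have [|i hi] := @divides_all R (size f) (fun j => f`_j) hR.
    by rewrite size_poly_gt0.
  exists i => j; have [lt_j|le_j] := ltnP j (size f); first exact: (hi (Ordinal lt_j)).
  by exists 0; rewrite nth_default // rmorph0 mulr0.
suff [a ea] : exists a : R, f`_i = tofrac a.
  by apply: poly_lift => j; have [b ->] := hi j; exists (a * b); rewrite ea rmorphM.
have [a [|ea]] := hR f`_i; first by exists a.
have [->|fi0] := eqVneq f`_i 0; first by exists 0; rewrite rmorph0.
have fia : f`_i * tofrac a = 1 by rewrite -ea divff.
suff [b eb] : exists b, g`_d = a * b.
  have ua : a \is a GRing.unit.
    by move: g_unit; rewrite eb unitrM => /andP[].
  exists a^-1; apply: (mulIf (x := tofrac a)); first by rewrite -ea invr_eq0.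
  by rewrite fia -rmorphM mulVr ?rmorph1.
(* After multiplication by a^(q^d), where 1/a is the coefficient f_i with the
  largest pole, every term of the coefficient of tau^(i+d) in f g = g f lies in
  aR, except for g_d f_i^(q^d), which becomes g_d. *)
pose P (x : {fraction R}) := exists b, x = tofrac (a * b).
have P0 : P 0 by exists 0; rewrite mulr0 rmorph0.
have PD x y : P x -> P y -> P (x + y).
  by case=> b -> [b' ->]; exists (b + b'); rewrite mulrDr rmorphD.
have Psum m (F : 'I_m -> {fraction R}) : (forall j, P (F j)) -> P (\sum_j F j).
  by move=> PF; apply: (big_ind P) => // j _.
have PM b x : P x -> P (tofrac b * x).
  by case=> b' ->; exists (b' * b); rewrite -rmorphM mulrC mulrA.
have fa j : exists b, f`_j * tofrac a = tofrac b.
  by have [b ->] := hi j; exists b; rewrite mulrAC fia mul1r.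
(* Each f_j a lies in R, so f_j^e a^m keeps a factor a as soon as e < m. *)
have PX j e m : (e < m)%N -> P (f`_j ^+ e * tofrac a ^+ m).
  move=> lt_em; have [b eb] := fa j.
  rewrite -(subnKC lt_em) addSnnS exprD mulrA -exprMn eb -rmorphXn.
  by apply: PM; exists (a ^+ (m - e.+1)); rewrite -exprS rmorphXn.
have lt_qd k : (k < d)%N -> (q ^ k < q ^ d)%N by rewrite ltn_exp2l ?q_gt1.
have /(congr1 (fun p : {poly _} => p`_(i + d) * tofrac a ^+ (q ^ d))) := fg.
rewrite !coef_skew_mul size_map_inj_poly ?rmorph0 //; last exact: tofrac_inj.
rewrite sg big_ord_recr /= ltnNge leq_addl addnK coef_map /= mulrDl.
rewrite -[_ * f`_i ^+ _ * _]mulrA -exprMn fia expr1n mulr1 !mulr_suml => e.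
suff [b /tofrac_inj eb] : P (tofrac g`_d) by exists b.
have -> : tofrac g`_d = \sum_(j < size f) f`_j *
    (if (i + d < j)%N then 0 else (map_poly (@tofrac R) g)`_(i + d - j) ^+ (#|Fq| ^ j)) *
      tofrac a ^+ (q ^ d)
  + - 1 * \sum_(k < d) (map_poly (@tofrac R) g)`_k *
    (if (i + d < k)%N then 0 else f`_(i + d - k) ^+ (#|Fq| ^ k)) * tofrac a ^+ (q ^ d).
  by rewrite e mulN1r addrAC subrr add0r.
apply: PD.
  apply: Psum => j; case: ifP => _; first by rewrite mulr0 mul0r.
  rewrite coef_map -rmorphXn mulrAC mulrC; apply: PM.
  (* In f g the coefficient f_j occurs only to the power 1 = q^0, which is below q^d because d >
     0. *)
  by rewrite -[f`_j]expr1; apply: PX; rewrite -(expn0 q) lt_qd.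
rewrite -(rmorph1 (@tofrac R)) -rmorphN; apply: (PM); apply: Psum => k.
case: ifP => _; first by rewrite mulr0 mul0r.
by rewrite coef_map -mulrA; apply: PM; apply: PX; apply: lt_qd.
Qed.

(** * The place at infinity *)

Section Curve.
Variables (Fq : finFieldType) (C : pointed_curve Fq).

Lemma ord_inf1 : ord_inf C 1 = 0.
Proof. by have [_ _ _ h _] := place_inf C; have := h 1; rewrite /= !rmorph1. Qed.

Lemma deg_inf_gt0 : (0 < deg_inf C)%N.
Proof.
have := deg_infP C; case: (deg_inf C) => // -[e [_ h]].
(* In degree 0 the sum is empty, so 1 itself would be zero or of positive order. *)
have [|c [/= + _]] := h 1; first by rewrite ord_inf1.
rewrite big_ord0 subr0 ord_inf1 => -[/eqP|//].
by rewrite oner_eq0.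
Qed.

(** An element of order 1 is a quotient a / b of elements of A, and a and b cannot both have order
    0. *)
Lemma ex_ord_inf_neq0 : exists2 a : C, a != 0 & ord_inf C (tofrac a) != 0.
Proof.
have [_ vM _ _ surj] := place_inf C; have [x x0 vx] := surj 1.
have [a [b [b0 e]]] := fractionP x.
have a0 : a != 0 by apply: contraNneq x0 => a0; rewrite e a0 rmorph0 mul0r.
have : ord_inf C (tofrac a) = 1 + ord_inf C (tofrac b).
  by rewrite -vx -vM ?tofrac_eq0 // e divfK ?tofrac_eq0.
have [->|bn0] := eqVneq (ord_inf C (tofrac b)) 0; last by exists b.
by move=> va; exists a => //; rewrite va.
Qed.

Lemma deg_at_eq0 r (a : C) : (0 < r)%N ->
  (deg_at r a == 0) = (ord_inf C (tofrac a) == 0).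
Proof.
move=> r0; have := deg_inf_gt0; rewrite oppr_eq0 !mulf_eq0 !eqz_nat => dC.
by rewrite !gtn_eqF // orbF.
Qed.

End Curve.

(** * Finite extensions of function fields *)

Section Covering.
Variables (Fq : finFieldType) (C' C : pointed_curve Fq) (n : nat).
Variable pi : covering C' C n.

Lemma covering_degree_gt0 : (0 < n)%N.
Proof.
rewrite lt0n; apply/eqP => n0; have [e he] := pull_degree pi.
have [c [/eqP]] := he 1; rewrite big1 ?oner_eq0 // => i.
by have := ltn_ord i; rewrite {2}n0.
Qed.

(** The powers 1, ..., x^n have coordinates in an n-dimensional space, so their coordinate matrix
    has a nonzero left kernel vector, whose entries are the coefficients of p. *)
Lemma covering_algebraic (x : {fraction C'}) :
  exists2 p : {poly {fraction C}}, p != 0 & (map_poly (pullF pi) p).[x] = 0.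
Proof.
have [e he] := pull_degree pi.
have /functional_choice[F hF] : forall j : 'I_n.+1,
    exists c : {ffun 'I_n -> {fraction C}}, x ^+ j = \sum_i pullF pi (c i) * e i.
  by move=> j; have [c [hc _]] := he (x ^+ j); exists c.
pose M := \matrix_(j < n.+1, i < n) F j i.
have kM0 : kermx M != 0.
  rewrite -mxrank_eq0 mxrank_ker -lt0n subn_gt0 ltnS.
  exact: rank_leq_col.
pose v := nz_row (kermx M).
have v0 : v != 0 by rewrite nz_row_eq0.
have vM : v *m M = 0 by apply/sub_kermxP/nz_row_sub.
exists (rVpoly v).
  by apply: contraNneq v0 => /(congr1 (@poly_rV _ n.+1)); rewrite rVpolyK linear0 => ->.
have sz : (size (map_poly (pullF pi) (rVpoly v)) <= n.+1)%N.
  by rewrite (leq_trans (size_poly _ _)) // size_poly.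
rewrite (horner_coef_wide _ sz).
transitivity (\sum_(i < n) pullF pi ((v *m M) 0 i) * e i).
  under [RHS]eq_bigr => i _ do rewrite mxE rmorph_sum mulr_suml.
  rewrite exchange_big /=; apply: eq_bigr => j _.
  rewrite coef_map coef_rVpoly_ord hF mulr_sumr; apply: eq_bigr => i _.
  by rewrite mxE rmorphM mulrA.
by rewrite vM big1 // => i _; rewrite mxE rmorph0 mul0r.
Qed.

(** An algebraic equation for a' can be given a nonzero constant term and coefficients in A; this
    constant term is then a multiple of a' in A'. *)
Lemma covering_divides_pull (a' : C') : a' != 0 ->
  exists (b' : C') (a : C), a != 0 /\ a' * b' = pull pi a.
Proof.
move=> a'0; have [p p0 hp] := covering_algebraic (tofrac a').
have [p1 p10 hp1] : exists2 p1 : {poly {fraction C}}, p1`_0 != 0 &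
    (map_poly (pullF pi) p1).[tofrac a'] = 0.
  (* Factors ['X] are split off while the constant term is zero; the root a' survives because it is
     nonzero. *)
  elim/poly_ind: p p0 hp => [|p x IH]; first by rewrite eqxx.
  have [->|x0] := eqVneq x 0; last first.
    by move=> _ hp; exists (p * 'X + x%:P); rewrite // coefD coefMX coefC add0r.
  rewrite addr0 => p0; rewrite rmorphM /= map_polyX hornerMX => /eqP.
  rewrite mulf_eq0 tofrac_eq0 (negbTE a'0) orbF => /eqP; apply: IH.
  by apply: contraNneq p0 => ->; rewrite mul0r.
have [d [p2 [d0 e2]]] := poly_common_denominator p1.
have hp2 : (map_poly (pull pi) p2).[a'] = 0.
  apply: (@tofrac_inj C'); rewrite rmorph0 -horner_map /= -map_poly_comp.
  rewrite (eq_map_poly (g := pullF pi \o @tofrac C)) => [|a]; last by rewrite /= pullFE.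
  by rewrite map_poly_comp e2 map_polyZ hornerZ hp1 mulr0.
have p20 : p2`_0 != 0.
  rewrite -(inj_eq (@tofrac_inj C)) -coef_map e2 coefZ rmorph0.
  by rewrite mulf_neq0 // tofrac_eq0.
(* Only the decomposition p2 X + b is used here: the equation at a' reads b = - a' p2(a'). *)
elim/poly_ind: p2 hp2 p20 {e2} => [|p2 b _]; first by rewrite coef0 eqxx.
rewrite coefD coefMX coefC add0r rmorphD rmorphM /= map_polyX map_polyC hornerD.
rewrite hornerMX hornerC => /eqP h b0; exists (- (map_poly (pull pi) p2).[a']), b.
split=> //; apply/eqP; rewrite mulrN eq_sym -addr_eq0 addrC mulrC.
exact: h.
Qed.

End Covering.

Lemma additive_inverses (I : Type) (U V : I -> zmodType)
    (f : forall i, {additive U i -> V i}) : (forall i, bijective (f i)) ->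
  exists g : forall i, {additive V i -> U i},
    forall i, cancel (f i) (g i) /\ cancel (g i) (f i).
Proof.
move=> f_bij.
have g_ex i : exists g : {additive V i -> U i}, cancel (f i) g /\ cancel g (f i).
  have [g fK gK] := f_bij i.
  have gB : zmod_morphism g.
    by move=> x y; apply: (can_inj fK); rewrite raddfB !gK.
  pose G := HB.pack_for {additive V i -> U i} g (GRing.isZmodMorphism.Build _ _ g gB).
  by exists G.
exists (fun i => sval (constructive_indefinite_description _ (g_ex i))) => i.
exact: svalP (constructive_indefinite_description _ (g_ex i)).
Qed.

(** * Drinfeld modules in coordinates *)

Section Presentation.
Variable Fq : finFieldType.
Local Notation q := #|Fq|.

(** [psi] is a coordinate over all of Spec B identifying the functor with the additive group; the
    values of [phi] stand for elements of B{tau}. *)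
Definition presented (A B : comNzRingType) (M : module_functor A B)
    (phi : A -> {poly B}) : Prop :=
  exists psi : forall X : algebra B, {additive M X -> X},
  [/\ forall (X Y : algebra B) (u : algebra_hom X Y) x,
        psi Y (fmap M u x) = u (psi X x),
      forall a X x, psi X (act M a X x) = tau_eval Fq (phi a) (psi X x)
    & forall X, bijective (psi X)].

Lemma presented_isomorphic (A B : comNzRingType) (M N : module_functor A B)
    (phi chi : A -> {poly B}) :
  presented M phi -> presented N chi -> phi =1 chi -> isomorphic M N.
Proof.
move=> [f [fN fA f_bij]] [g [gN gA g_bij]] e.
have [h hP] := additive_inverses g_bij.
exists (fun X => h X \o f X); split=> [X Y u x|a X x|X] /=.
- apply: (bij_inj (g_bij Y)); rewrite gN.
  by have [_ ->] := hP X; have [_ ->] := hP Y; rewrite fN.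
- apply: (bij_inj (g_bij X)); rewrite gA.
  by have [_ hK] := hP X; rewrite !hK fA e.
- apply: bij_comp (f_bij X); have [gK hK] := hP X; exact: (Bijective hK gK).
Qed.

Lemma isomorphic_presented (A B : comNzRingType) (M N : module_functor A B)
    (phi : A -> {poly B}) :
  isomorphic M N -> presented N phi -> presented M phi.
Proof.
move=> [f [fN fA f_bij]] [g [gN gA g_bij]].
exists (fun X => g X \o f X); split=> [X Y u x|a X x|X] /=.
- by rewrite fN gN.
- by rewrite fA gA.
exact: bij_comp (g_bij X) (f_bij X).
Qed.

Lemma tau_eval_restrict (B B' : comNzRingType) (h : {rmorphism B -> B'})
    (d : {poly B}) (X : algebra B') (x : X) :
  tau_eval Fq (map_poly h d) x = @tau_eval Fq B d (restrict h X) x.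
Proof.
rewrite (tau_eval_wide Fq x (size_poly _ _)).
by apply: eq_bigr => i _; rewrite coef_map.
Qed.

Lemma presented_base_change (A B B' : comNzRingType) (h : {rmorphism B -> B'})
    (M : module_functor A B) (phi : A -> {poly B}) :
  presented M phi -> presented (base_change h M) (fun a => map_poly h (phi a)).
Proof.
move=> [f [fN fA f_bij]]; exists (fun X => f (restrict h X)).
split=> [X Y u x|a X x|X] /=.
- exact: (fN _ _ (restrict_hom h u)).
- by rewrite fA tau_eval_restrict.
exact: (f_bij (restrict h X)).
Qed.

Lemma presented_push (A A' B : comNzRingType) (p : {rmorphism A -> A'})
    (M : module_functor A' B) (phi : A' -> {poly B}) :
  presented M phi -> presented (push p M) (fun a => phi (p a)).
Proof.
by move=> [f [fN fA f_bij]]; exists f; split=> //= a X x; rewrite fA.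
Qed.

(** These are the ring homomorphisms A -> B{tau}. *)
Definition skew_morphism (A B : comNzRingType) (phi : A -> {poly B}) : Prop :=
  [/\ phi 1 = 1, {morph phi : a b / a + b}
    & forall a b, phi (a * b) = skew_mul Fq (phi a) (phi b)].

(** An element of B{tau} is determined by its value at the universal point, so the module axioms
    tested there become identities between values of [phi]. *)
Lemma presented_skew_morphism (A B : comNzRingType) (k : {rmorphism Fq -> B})
    (M : module_functor A B) (phi : A -> {poly B}) :
  presented M phi -> skew_morphism phi.
Proof.
move=> [f [fN fA f_bij]]; have [g _ gK] := f_bij (poly_algebra B).
have phiP a (d : {poly B}) :
    f _ (act M a (poly_algebra B) (g 'X)) = tau_eval Fq d ('X : poly_algebra B) ->
    phi a = d.
  by rewrite fA gK => /tau_evalX_inj.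
split=> [|a b|a b]; apply: phiP.
- by rewrite act1 gK tau_evalC rmorph1 mul1r.
- by rewrite actD raddfD /= !fA gK tau_evalD.
- by rewrite actM !fA gK (tau_eval_skew_mul k).
Qed.

Section AdditiveGroup.
Variables (A B : comNzRingType) (k : {rmorphism Fq -> B}).
Variables (phi : A -> {poly B}) (phiP : skew_morphism phi).

Lemma tau_eval_is_zmod_morphism (d : {poly B}) (X : algebra B) :
  zmod_morphism (@tau_eval Fq B d X).
Proof.
have tauD (x y : X) : tau_eval Fq d (x + y) = tau_eval Fq d x + tau_eval Fq d y.
  rewrite /tau_eval -big_split; apply: eq_bigr => i _ /=.
  by rewrite (exprDn_card (alg_str X \o k)) mulrDr.
by move=> x y; apply: (canRL (addrK _)); rewrite -tauD subrK.
Qed.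

Definition tau_additive (d : {poly B}) (X : algebra B) : {additive X -> X} :=
  HB.pack_for {additive X -> X} (@tau_eval Fq B d X)
    (GRing.isZmodMorphism.Build X X _ (tau_eval_is_zmod_morphism d (X := X))).

Definition additive_group : module_functor A B.
Proof.
refine (@ModuleFunctor A B (fun X => X) (fun X Y u => u) _ _
  (fun a X => tau_additive (phi a) X) _ _ _ _) => //=.
- by move=> a X Y u x; apply: tau_eval_hom.
- by move=> X x; have [-> _ _] := phiP; rewrite tau_evalC rmorph1 mul1r.
- by move=> a b X x; have [_ -> _] := phiP; rewrite tau_evalD.
- by move=> a b X x; have [_ _ ->] := phiP; rewrite (tau_eval_skew_mul k).
Defined.

Lemma additive_group_presented : presented additive_group phi.
Proof.
exists (fun X => idfun); split=> //= X; exact: (@Bijective _ _ _ id).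
Qed.

(** The polynomial ring represents the functor; the universal point is the one with coordinate
    ['X]. *)
Lemma presented_representable (M : module_functor A B) :
  presented M phi -> representable M.
Proof.
move=> [f [fN fA f_bij]]; have [g _ gK] := f_bij (poly_algebra B).
exists (poly_algebra B), (g 'X) => X x; exists (eval_hom (f X x)); split.
  by apply: (bij_inj (f_bij X)); rewrite fN gK eval_homX.
move=> v ev; apply: eval_hom_unique.
by rewrite -ev fN gK.
Qed.

End AdditiveGroup.

(** By naturality the automorphism and its inverse are polynomials P and Q with P(Q) = X. Over a
    domain degrees multiply, so P has degree 1, and additivity removes its constant term. *)
Lemma additive_group_automorphism (B : idomainType)
    (f : forall X : algebra B, {additive X -> X}) :
  (forall (X Y : algebra B) (u : algebra_hom X Y) x, f Y (u x) = u (f X x)) ->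
  (forall X, bijective (f X)) ->
  exists2 b : B, b \is a GRing.unit & forall X x, f X x = alg_str X b * x.
Proof.
move=> fN f_bij; have [g gP] := additive_inverses f_bij.
pose T : poly_algebra B := 'X.
pose P : {poly B} := f _ T; pose Q : {poly B} := g _ T.
have fE X x : f X x = eval_hom x P.
  by rewrite -{1}(eval_homX x) fN.
have PQ : P \Po Q = 'X.
  by rewrite -eval_hom_comp -fE; have [_ ->] := gP (poly_algebra B).
have P0 : P`_0 = 0.
  have := fE (poly_algebra B) 0; rewrite raddf0 eval_hom_comp => /(congr1 (horner^~ 0)).
  by rewrite horner_comp !hornerC horner_coef0.
have := size_comp_poly P Q; rewrite PQ size_polyX => /esym/eqP.
rewrite muln_eq1 => /andP[/eqP sP /eqP sQ].
have P1 : P = P`_1 *: 'X.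
  apply/polyP => i; rewrite coefZ coefX; case: i => [|[|i]]; rewrite ?mulr0 ?mulr1 //.
  by rewrite nth_default //; case: (size P) sP => [|[|[]]].
exists P`_1; last first.
  move=> X x; rewrite fE P1 coefZ coefX mulr1.
  by rewrite -mul_polyC rmorphM /= horner_alg_strC horner_alg_strX.
apply/unitrPr; exists Q`_1.
have := congr1 (fun p : {poly B} => p`_1) PQ.
by rewrite {1}P1 linearZ /= comp_polyX coefZ coefX.
Qed.

(** The hypothesis is the equation e b = b d of B{tau}, coefficient by coefficient. Changes of
    coordinates are expressed in this form throughout. *)
Lemma tau_eval_scale (B : comNzRingType) (d e : {poly B}) b (X : algebra B) (x : X) :
  (forall i, e`_i * b ^+ (q ^ i) = b * d`_i) ->
  tau_eval Fq e (alg_str X b * x) = alg_str X b * tau_eval Fq d x.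
Proof.
move=> ed; have [ld le] := (leq_maxl (size d) (size e), leq_maxr (size d) (size e)).
rewrite (tau_eval_wide Fq _ ld) (tau_eval_wide Fq _ le) mulr_sumr.
apply: eq_bigr => i _; rewrite mulrA -rmorphM -ed exprMn rmorphM rmorphXn.
by rewrite mulrA.
Qed.

(** One coordinate composed with the inverse of the other is an automorphism of the additive
    group. *)
Lemma trivializations_proportional (A : comNzRingType) (B : idomainType)
    (M : module_functor A B) (f g : forall X : algebra B, {additive M X -> X}) :
  (forall (X Y : algebra B) (u : algebra_hom X Y) x, f Y (fmap M u x) = u (f X x)) ->
  (forall (X Y : algebra B) (u : algebra_hom X Y) x, g Y (fmap M u x) = u (g X x)) ->
  (forall X, bijective (f X)) -> (forall X, bijective (g X)) ->
  exists2 b : B, b \is a GRing.unit & forall X x, g X x = alg_str X b * f X x.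
Proof.
move=> fN gN f_bij g_bij; have [h hP] := additive_inverses f_bij.
have hK X : cancel (h X) (f X) by have [] := hP X.
have [|X|b b_unit bE] := @additive_group_automorphism B (fun X => g X \o h X).
- move=> X Y u x /=; rewrite -gN; congr (g Y _).
  by apply: (bij_inj (f_bij Y)); rewrite hK fN hK.
- apply: bij_comp; first exact: g_bij.
  by have [fK _] := hP X; exact: Bijective (hK X) fK.
exists b => // X x.
by have [fK _] := hP X; rewrite -bE /= fK.
Qed.

Lemma presented_unique (A : comNzRingType) (B : idomainType)
    (M : module_functor A B) (phi chi : A -> {poly B}) :
  presented M phi -> presented M chi ->
  exists2 b : B, b \is a GRing.unit &
    forall a i, (chi a)`_i * b ^+ (q ^ i) = b * (phi a)`_i.
Proof.
move=> [f [fN fA f_bij]] [g [gN gA g_bij]].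
have [b b_unit gE] := trivializations_proportional fN gN f_bij g_bij.
exists b => // a i; pose T : poly_algebra B := 'X.
have [h _ hK] := f_bij (poly_algebra B).
have := gA a _ (h T); rewrite !gE fA hK -tau_evalZ.
(* This is the product of [chi a] and b in B{tau}. *)
pose d := \poly_(j < size (chi a)) ((chi a)`_j * b ^+ (q ^ j)).
have -> : tau_eval Fq (chi a) (alg_str _ b * T) = tau_eval Fq d T.
  rewrite [RHS](tau_eval_wide Fq _ (size_poly _ _)); apply: eq_bigr => j _.
  by rewrite coef_poly ltn_ord exprMn mulrA rmorphM rmorphXn.
move=> /tau_evalX_inj /(congr1 (fun p : {poly B} => p`_i)).
rewrite coefZ coef_poly => ->; case: ltnP => // le_i.
by rewrite nth_default ?mul0r.
Qed.

Lemma presented_scale (A : comNzRingType) (B : idomainType)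
    (M : module_functor A B) (phi chi : A -> {poly B}) (b : B) :
  b \is a GRing.unit ->
  (forall a i, (chi a)`_i * b ^+ (q ^ i) = b * (phi a)`_i) ->
  presented M phi -> presented M chi.
Proof.
move=> b_unit e [f [fN fA f_bij]].
have mulB (X : algebra B) : zmod_morphism (fun x : X => alg_str X b * x).
  by move=> x y; rewrite mulrBr.
pose m (X : algebra B) : {additive X -> X} := HB.pack_for {additive X -> X}
  (fun x : X => alg_str X b * x) (GRing.isZmodMorphism.Build X X _ (mulB X)).
exists (fun X => m X \o f X); split=> [X Y u x|a X x|X] /=.
- by rewrite fN rmorphM alg_homE.
- by rewrite fA (tau_eval_scale _ (e a)).
apply: bij_comp (f_bij X); exists (fun x : X => alg_str X b^-1 * x) => x.
  by rewrite /= mulrA -rmorphM mulVr // rmorph1 mul1r.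
by rewrite /= mulrA -rmorphM divrr // rmorph1 mul1r.
Qed.

End Presentation.

(** * From Drinfeld modules to coefficients and back *)

Lemma fmap_cancel (A B : comNzRingType) (M : module_functor A B) (X Y : algebra B)
    (u : algebra_hom X Y) (v : algebra_hom Y X) :
  cancel u v -> cancel (fmap M u) (fmap M v).
Proof.
move=> uK x; pose w := @AlgebraHom B X X idfun (fun=> erefl).
rewrite -[RHS](@fmap_id _ _ M X w) // (fmap_comp (u := u) (v := v) (w := w)) //.
by move=> y; rewrite /= uK.
Qed.

Lemma localization_unit (B : comNzRingType) (D : comUnitRingType) (h : {rmorphism D -> B})
    (f : D) : localization h f -> f \is a GRing.unit ->
  exists g : {rmorphism B -> D}, cancel h g /\ cancel g h.
Proof.
move=> [[hker hsurj] _] f_unit.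
have h_inj : injective h.
  move=> x y e; apply/eqP; rewrite -subr_eq0; apply/eqP.
  have [|N] := hker (x - y); first by rewrite rmorphB e subrr.
  by move=> /(congr1 ( *%R (f ^- N))); rewrite mulKr ?unitrX // mulr0.
have /functional_choice[g gK] : forall b, exists x, h x = b.
  move=> b; have [N [x e]] := hsurj b; exists (f ^- N * x).
  by rewrite rmorphM -e -rmorphXn mulrA -rmorphM mulVr ?unitrX // rmorph1 mul1r.
have gB : zmod_morphism g by move=> x y; apply: h_inj; rewrite rmorphB !gK.
have gM : monoid_morphism g.
  by split=> [|x y]; apply: h_inj; rewrite ?rmorph1 ?rmorphM !gK.
pose G := HB.pack_for {rmorphism B -> D} g
  (GRing.isZmodMorphism.Build _ _ g gB) (GRing.isMonoidMorphism.Build _ _ g gM).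
by exists G; split=> // x; apply: h_inj; rewrite /= gK.
Qed.

Section Drinfeld.
Variables (Fq : finFieldType) (C : pointed_curve Fq).
Local Notation q := #|Fq|.

(** Over a domain nilpotent coefficients vanish, so the rank condition fixes the exact degree in
    tau. The clause on constants records Fq-linearity of the coordinate. *)
Definition drinfeld_coefs (r : nat) (B : idomainType) (c : C -> B)
    (phi : C -> {poly B}) : Prop :=
  [/\ forall a, (phi a)`_0 = c a,
      forall x : Fq, phi (cst C x) = (c (cst C x))%:P
    & forall a, a != 0 -> exists i : nat,
        [/\ i%:Z = deg_at r a, size (phi a) = i.+1 & (phi a)`_i \is a GRing.unit]].

(** Locality in the form suited to coverings: if finitely many D(f_i) cover Spec B, one of them is
    all of Spec B. *)
Definition local_ring (B : comUnitRingType) : Prop :=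
  forall m (f u : 'I_m -> B), \sum_i u i * f i = 1 ->
    exists i, f i \is a GRing.unit.

(** Some member of the trivializing cover is all of Spec B, so its coordinate, transported along the
    inverse of the localization map, is global. *)
Lemma drinfeld_presented r (B : idomainType) (c : {rmorphism C -> B})
    (M : module_functor C B) : local_ring B -> drinfeld r c M ->
  exists2 phi, presented Fq M phi & drinfeld_coefs r c phi.
Proof.
move=> B_local [_ [m [f [u [fu1 cover]]]] hM].
have [i fi_unit] := B_local _ _ _ fu1.
have {cover} [B' [h [h_loc [psi psiP]]]] := cover i.
have [g [hK gK]] := localization_unit h_loc fi_unit.
have h_open : affine_open h.
  have [h_iso [y hy]] := h_loc; exists 1%N, (fun=> f i), (fun=> y).
  by split=> [|_ //]; rewrite big_ord1 mulrC.
have [psiN psiF psi_bij] := psiP.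
(* X and [restrict h (restrict g X)] have the same ring and, by [hK], pointwise equal structure
   maps; the identity is an algebra map both ways. *)
pose to (X : algebra B) := @AlgebraHom B X (restrict h (restrict g X)) idfun
  (fun b => congr1 (alg_str X) (esym (hK b))).
pose from (X : algebra B) := @AlgebraHom B (restrict h (restrict g X)) X idfun
  (fun b => congr1 (alg_str X) (hK b)).
pose chi (X : algebra B) : {additive M X -> X} := psi (restrict g X) \o fmap M (to X).
have chiN (X Y : algebra B) (w : algebra_hom X Y) x : chi Y (fmap M w x) = w (chi X x).
  rewrite /chi /= -[RHS](psiN _ _ (restrict_hom g w)).
  pose w' := @AlgebraHom B X (restrict h (restrict g Y)) w
    (fun b => etrans (alg_homE w b) (congr1 (alg_str Y) (esym (hK b)))).
  apply: (congr1 (psi (restrict g Y))).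
  rewrite -[LHS](fmap_comp (u := w) (v := to Y) (w := w')) //.
  by rewrite -[RHS](fmap_comp (u := to X) (v := restrict_hom h (restrict_hom g w)) (w := w')).
have chi_bij X : bijective (chi X).
  apply: bij_comp; first exact: (psi_bij (restrict g X)).
  by exists (fmap M (from X)); apply: fmap_cancel.
have chiA (a : C) X x (d : {poly B'}) :
    (forall (X : algebra B') (x : M (restrict h X)),
      psi X (act M a (restrict h X) x) = tau_eval Fq d (psi X x)) ->
    chi X (act M a X x) = tau_eval Fq (map_poly g d) (chi X x).
  by move=> hd; rewrite /chi /= act_nat hd tau_eval_restrict.
have /functional_choice[phi phiP] : forall a : C, exists d : {poly B},
    (forall X x, chi X (act M a X x) = tau_eval Fq d (chi X x)) /\
    (d`_0 = c a /\ (a != 0 -> exists i : nat,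
        [/\ i%:Z = deg_at r a, size d = i.+1 & d`_i \is a GRing.unit])).
  move=> a; have [->|a0] := eqVneq a 0.
    exists 0; split; last by rewrite coef0 rmorph0.
    move=> X x; rewrite tau_eval0 -[RHS](raddf0 (chi X)); congr (chi X _).
    by apply: (addrI (act M 0 X x)); rewrite -actD !addr0.
  have [d [dA d0 [j [jdeg [y dy]]] dnil]] := hM _ _ h_open psi psiP a a0.
  exists (map_poly g d); split=> [X x|]; first exact: chiA.
  split=> [|_]; first by rewrite coef_map d0 /= hK.
  have dj_unit : (map_poly g d)`_j \is a GRing.unit.
    by apply/unitrPr; exists (g y); rewrite coef_map -rmorphM dy rmorph1.
  exists j; split=> //; apply/eqP; rewrite eqn_leq; apply/andP; split.
    apply/leq_sizeP => k lt_jk; have [|N /(congr1 g)] := dnil k.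
      by rewrite -jdeg ltz_nat.
    rewrite rmorphXn rmorph0 coef_map => /eqP; rewrite expf_eq0 => /andP[_ /eqP].
    by [].
  rewrite ltnNge; apply: contraL dj_unit => le_j.
  by rewrite nth_default // unitr0.
exists phi; first by exists chi; split=> // a X x; have [-> _] := phiP a.
split=> [a|x|a]; [by have [_ []] := phiP a| |by have [_ []] := phiP a].
have [k _ kK] := chi_bij (poly_algebra B).
apply: (@tau_evalX_inj Fq); have [e _] := phiP (cst C x).
have := e _ (k ('X : poly_algebra B)); rewrite kK => <-.
rewrite tau_evalC -{2}['X]kK /chi /= act_nat psiF /=.
by rewrite hK.
Qed.

(** Some f_i divides all the others, so the whole relation is a multiple of its image. *)
Lemma valuation_ring_principal (R : idomainType) (B : comNzRingType)
    (h : {rmorphism R -> B}) m (f : 'I_m -> R) (u : 'I_m -> B) :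
  valuation_ring R -> \sum_i u i * h (f i) = 1 -> exists i y, h (f i) * y = 1.
Proof.
move=> hR fu1.
have m_gt0 : (0 < m)%N.
  rewrite lt0n; apply/eqP => m0; move: fu1; rewrite big1 => [/esym/eqP|i].
    by rewrite oner_eq0.
  by have := ltn_ord i; rewrite {2}m0.
have [i hi] := divides_all (fun i => tofrac (f i)) hR m_gt0; exists i.
have /functional_choice[e he] : forall j, exists e, f j = f i * e.
  by move=> j; have [e he] := hi j; exists e; apply: tofrac_inj; rewrite rmorphM.
exists (\sum_j u j * h (e j)); rewrite -fu1 mulr_sumr; apply: eq_bigr => j _.
by rewrite (he j) rmorphM mulrCA.
Qed.

Lemma valuation_ring_local (R : idomainType) : valuation_ring R -> local_ring R.
Proof.
move=> hR m f u fu1.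
have [i [y e]] := @valuation_ring_principal R R idfun m f u hR fu1.
by exists i; apply/unitrPr; exists y.
Qed.

Lemma field_local (K : fieldType) : local_ring K.
Proof.
move=> m f u fu1; apply/existsP; apply: contraTT isT; rewrite negb_exists => /forallP h.
move/eqP: fu1; rewrite big1 => [|i _]; first by rewrite eq_sym oner_eq0.
by have := h i; rewrite unitfE negbK => /eqP ->; rewrite mulr0.
Qed.

(** One f_i becomes invertible in B, so B is the localization of R at this single nonzero element
    and inherits integrality. *)
Lemma affine_open_integral (R : idomainType) (B : comNzRingType)
    (h : {rmorphism R -> B}) : valuation_ring R -> affine_open h ->
  forall x y : B, x * y = 0 -> x = 0 \/ y = 0.
Proof.
move=> hR [m [f [u [fu1 f_iso]]]] x y xy0.
have [i [z fz]] := valuation_ring_principal hR fu1.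
have [hker hsurj] := f_iso i; set t := f i in fz hker hsurj.
have t0 : t != 0.
  by apply: contraTneq isT => t0; move/eqP: fz; rewrite t0 rmorph0 mul0r eq_sym oner_eq0.
have tz N b : h t ^+ N * b = 0 -> b = 0.
  by move=> /(congr1 ( *%R (z ^+ N))); rewrite mulrA -exprMn [z * _]mulrC fz expr1n mul1r mulr0.
have h0 b : h b = 0 -> b = 0.
  move=> /hker[N /eqP]; rewrite mulf_eq0 expf_eq0 (negbTE t0) andbF.
  by move=> /eqP.
have [N [a ea]] := hsurj x; have [N' [b eb]] := hsurj y.
have /eqP : a * b = 0.
  by apply: h0; rewrite rmorphM -ea -eb mulrACA xy0 mulr0.
rewrite mulf_eq0 => /orP[] /eqP e0; [left; apply: (tz N)|right; apply: (tz N')].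
  by rewrite ea e0 rmorph0.
by rewrite eb e0 rmorph0.
Qed.

(** Affine opens of Spec R are spectra of domains, so every trivialization over one is a unit
    multiple of the global coordinate, and conjugation by a unit preserves the required shape. *)
Lemma presented_drinfeld r (R : idomainType) (c : {rmorphism C -> R})
    (M : module_functor C R) (phi : C -> {poly R}) :
  valuation_ring R -> presented Fq M phi -> drinfeld_coefs r c phi -> drinfeld r c M.
Proof.
move=> hR M_phi [phi0 phi_cst phi_lead]; have [f [fN fA f_bij]] := M_phi.
split; first exact: presented_representable M_phi.
  exists 1%N, (fun=> 1), (fun=> 1); split; first by rewrite big_ord1 mulr1.
  move=> _; exists R, idfun; split.
    split; last by exists 1; rewrite mulr1.
    split=> b; first by move=> /= ->; exists 0; rewrite mulr0.
    by exists 0, b; rewrite expr0 mul1r.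
  exists (fun X => f (restrict idfun X)); split=> [X Y u x|a X x|X].
  - exact: (fN _ _ (restrict_hom idfun u)).
  - by rewrite fA phi_cst tau_evalC.
  - exact: (f_bij (restrict idfun X)).
move=> B' h h_open psi [psiN _ psi_bij] a a0.
have [D eD] := comNzRing_integral (affine_open_integral hR h_open).
move: h psi {h_open} psiN psi_bij; rewrite -{B'}eD => h psi psiN psi_bij.
have [b b_unit psiE] := @trivializations_proportional _ _ (base_change h M)
  (fun X => f (restrict h X)) psi
  (fun X Y u => fN _ _ (restrict_hom h u)) psiN (fun X => f_bij (restrict h X)) psi_bij.
have [i [ideg si ui]] := phi_lead a a0.
(* These are the coefficients of b phi(a) b^-1 in D{tau}. *)
pose d : {poly D} := \poly_(j < i.+1) (b * h (phi a)`_j / b ^+ (q ^ j)).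
exists d; split=> [X x||| j].
- rewrite !psiE fA -tau_eval_restrict; symmetry; apply: tau_eval_scale => j.
  rewrite coef_poly coef_map /=; case: ltnP => [_|le_ij].
    by rewrite divrK ?unitrX.
  by rewrite nth_default ?si // rmorph0 mul0r mulr0.
- by rewrite coef_poly /= expn0 expr1 phi0 mulrAC divrr ?mul1r.
- exists i; split=> //; apply/unitrPr; rewrite coef_poly ltnSn.
  by rewrite unitrM unitrV unitrX // unitrM b_unit rmorph_unit.
rewrite -ideg ltz_nat => lt_ij; exists 1%N.
by rewrite coef_poly ltnNge lt_ij expr1.
Qed.

End Drinfeld.

(** Over a domain degrees in tau add and the leading coefficient of the product is f_i g_j^(q^i), so
    f_i divides a unit. *)
Lemma skew_mul_unit_lead (Fq : finFieldType) (B : idomainType) (f g : {poly B}) i j k :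
  size f = i.+1 -> size g = j.+1 -> size (skew_mul Fq f g) = k.+1 ->
  (skew_mul Fq f g)`_k \is a GRing.unit -> f`_i \is a GRing.unit.
Proof.
move=> sf sg sfg.
have lead_neq0 (h : {poly B}) m : size h = m.+1 -> h`_m != 0.
  by move=> sh; have := lead_coef_eq0 h; rewrite lead_coefE sh -size_poly_eq0 sh => /= ->.
have -> : k = (i + j)%N.
  apply/eqP; rewrite eqn_leq -ltnS -sfg (size_skew_mul_leq Fq sf sg) /=.
  rewrite -ltnS -sfg ltnNge; apply/negP => /leq_sizeP/(_ _ (leqnn _))/eqP.
  rewrite (coef_skew_mul_top _ sf sg) mulf_eq0 expf_eq0.
  by rewrite (negbTE (lead_neq0 _ _ sf)) (negbTE (lead_neq0 _ _ sg)) andbF.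
by rewrite (coef_skew_mul_top _ sf sg) unitrM => /andP[].
Qed.

Section Scaling.
Variables (Fq : finFieldType) (C : pointed_curve Fq) (r : nat).
Local Notation q := #|Fq|.

Lemma drinfeld_coefs_nonconstant (B : idomainType) (c : C -> B) (phi : C -> {poly B}) :
  (0 < r)%N -> drinfeld_coefs r c phi ->
  exists (a : C) (d : nat),
    [/\ d%:Z = deg_at r a, (0 < d)%N, a != 0 & size (phi a) = d.+1 /\ (phi a)`_d \is a GRing.unit].
Proof.
move=> r_gt0 [_ _ phi_lead]; have [a a0 va] := ex_ord_inf_neq0 C.
have [d [hd sd ud]] := phi_lead a a0; exists a, d; split=> //.
by rewrite lt0n -eqz_nat hd deg_at_eq0.
Qed.

Lemma drinfeld_coefs_scale (B : idomainType) (c : C -> B) (phi chi : C -> {poly B}) b :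
  b \is a GRing.unit ->
  (forall a i, (chi a)`_i * b ^+ (q ^ i) = b * (phi a)`_i) ->
  drinfeld_coefs r c phi -> drinfeld_coefs r c chi.
Proof.
move=> b_unit e [phi0 phi_cst phi_lead].
have chiE a i : (chi a)`_i = b / b ^+ (q ^ i) * (phi a)`_i.
  by apply: (mulIr (unitrX (q ^ i) b_unit)); rewrite e mulrAC divrK ?unitrX.
have chi0 a : (chi a)`_0 = c a by rewrite chiE expr1 divrr // mul1r.
split=> // [x|a a0].
  apply/polyP => -[|i]; first by rewrite chi0 coefC.
  by rewrite chiE phi_cst !coefC mulr0.
have [i [hi si ui]] := phi_lead a a0; exists i.
have ui' : (chi a)`_i \is a GRing.unit.
  by rewrite chiE !unitrM unitrV unitrX ?b_unit.
split=> //; apply/eqP; rewrite eqn_leq; apply/andP; split.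
  by apply/leq_sizeP => j ltij; rewrite chiE nth_default ?si // mulr0.
by rewrite ltnNge; apply: contraL ui' => le_i; rewrite nth_default // unitr0.
Qed.

Lemma presented_descent (R : idomainType) (c : C -> R) (M : module_functor C R)
    (phi chi : C -> {poly R}) :
  valuation_ring R -> (0 < r)%N -> drinfeld_coefs r c phi -> drinfeld_coefs r c chi ->
  presented Fq M phi ->
  presented Fq (base_change (@tofrac R) M) (fun a => map_poly (@tofrac R) (chi a)) ->
  presented Fq M chi.
Proof.
move=> hR r_gt0 phiP [_ _ chi_lead] M_phi MK_chi.
have [b b_unit e] := presented_unique (presented_base_change (@tofrac R) M_phi) MK_chi.
have [a [d [hd d_gt0 a0 [_ phi_unit]]]] := drinfeld_coefs_nonconstant r_gt0 phiP.
have chi_unit : (chi a)`_d \is a GRing.unit.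
  by have [d' [+ _]] := chi_lead a a0; rewrite -hd => -[->].
have q_gt0 : (0 < (q ^ d).-1)%N.
  by rewrite -ltnS prednK ?expn_gt0 ?(ltnW (q_gt1 Fq)) // -(expn0 q) ltn_exp2l ?q_gt1.
(* The coefficients of tau^d exhibit b^(q^d - 1) as a quotient of units of R. *)
have bX : b ^+ (q ^ d).-1 * tofrac (chi a)`_d = tofrac (phi a)`_d.
  apply: (mulIr b_unit); rewrite mulrAC -exprSr prednK ?expn_gt0 ?(ltnW (q_gt1 Fq)) //.
  by have := e a d; rewrite !coef_map /= mulrC => ->; rewrite mulrC.
(* Whichever of b and 1/b lies in R has a positive power dividing a unit, hence is a unit of R. *)
have [b0 b0_unit b0E] : exists2 b0 : R, b0 \is a GRing.unit & b = tofrac b0.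
  have [s [bs|bs]] := hR b.
    exists s => //; rewrite -(unitrX_pos _ q_gt0).
    move: bX; rewrite bs -rmorphXn -rmorphM => /tofrac_inj sX.
    by move: phi_unit; rewrite -sX unitrM => /andP[].
  have s_unit : s \is a GRing.unit.
    rewrite -(unitrX_pos _ q_gt0).
    have : tofrac (s ^+ (q ^ d).-1 * (phi a)`_d) = tofrac (chi a)`_d.
      by rewrite rmorphM rmorphXn /= -bs -bX exprVn mulKr ?unitrX.
    by move/tofrac_inj => sX; move: chi_unit; rewrite -sX unitrM => /andP[].
  exists s^-1; first by rewrite unitrV.
  apply: (mulIr (x := tofrac s)); first by rewrite rmorph_unit.
  by rewrite -rmorphM mulVr // rmorph1 -bs divrr.
apply: (presented_scale b0_unit _ M_phi) => a' i; apply: tofrac_inj.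
by have := e a' i; rewrite b0E !coef_map /= -rmorphXn -!rmorphM.
Qed.

End Scaling.

(** * Extension of the module from K to R, and its uniqueness *)

Theorem theorem2p4 (Fq : finFieldType) (C C' : pointed_curve Fq) (n : nat)
  (pi : covering C' C n) (r' : nat) (hr' : (0 < r')%N)
  (R : idomainType) (hR : valuation_ring R)
  (c : {rmorphism C -> R}) (M : module_functor C R)
  (hM : drinfeld (n * r') c M)
  (c' : {rmorphism C' -> {fraction R}}) (M' : module_functor C' {fraction R})
  (hM' : drinfeld r' c' M')
  (hc : forall a : C, c' (pull pi a) = tofrac (c a))
  (hiso : isomorphic (base_change (@tofrac R) M) (push (pull pi) M')) :
  exists ct : {rmorphism C' -> R},
    [/\ forall a' : C', tofrac (ct a') = c' a',
        forall a : C, ct (pull pi a) = c a,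
        forall ct2 : {rmorphism C' -> R},
          (forall a' : C', tofrac (ct2 a') = c' a') ->
          (forall a : C, ct2 (pull pi a) = c a) -> ct2 =1 ct
      & exists Mt : module_functor C' R,
          [/\ drinfeld r' ct Mt,
              isomorphic (base_change (@tofrac R) Mt) M',
              isomorphic (push (pull pi) Mt) M
            & forall Mt2 : module_functor C' R,
                drinfeld r' ct Mt2 ->
                isomorphic (base_change (@tofrac R) Mt2) M' ->
                isomorphic (push (pull pi) Mt2) M ->
                isomorphic Mt2 Mt]].
Proof.
have k : {rmorphism Fq -> R} := c \o cst C.
have [phi M_phi phiP] := drinfeld_presented (valuation_ring_local hR) hM.
have [phi' M'_phi' phi'P] := drinfeld_presented (@field_local _) hM'.
have [b b_unit bE] := presented_unique
  (isomorphic_presented hiso (presented_push (pull pi) M'_phi'))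
  (presented_base_change (@tofrac R) M_phi).
(* Here b compares the coordinate carried over from M' with the one coming from R; conjugating phi'
   by it makes chi extend phi. *)
pose chi a' := \poly_(i < size (phi' a')) (b * (phi' a')`_i / b ^+ (#|Fq| ^ i)).
have chiE a' i : (chi a')`_i * b ^+ (#|Fq| ^ i) = b * (phi' a')`_i.
  rewrite coef_poly; case: ltnP => [_|le_i]; first by rewrite divrK ?unitrX.
  by rewrite nth_default // mulr0 mul0r.
have M'_chi := presented_scale b_unit chiE M'_phi'.
have [chi0 chi_cst chi_lead] := drinfeld_coefs_scale b_unit chiE phi'P.
have [chi1 chiD chiM] := presented_skew_morphism (@tofrac R \o k) M'_chi.
have chi_pull a : chi (pull pi a) = map_poly (@tofrac R) (phi a).
  apply/polyP => i; apply: (mulIr (unitrX (#|Fq| ^ i) b_unit)).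
  by rewrite chiE bE.
have nr_gt0 : (0 < n * r')%N by rewrite muln_gt0 hr' (covering_degree_gt0 pi).
have [a0 [d [_ d_gt0 _ [sd ud]]]] := drinfeld_coefs_nonconstant nr_gt0 phiP.
have /functional_choice[phit phitE] a' : exists f, chi a' = map_poly (@tofrac R) f.
  (* Commutativity of A' makes chi(a') commute with the image of phi(a0). *)
  apply: (skew_commute_integral (Fq := Fq) hR sd d_gt0 ud).
  by rewrite -chi_pull -!chiM mulrC.
have map_inj : injective (map_poly (@tofrac R)).
  exact: map_inj_poly (@tofrac_inj R) (rmorph0 _).
have phit_skew : skew_morphism Fq phit.
  split=> [|a b'|a b']; apply: map_inj.
  - by rewrite -phitE chi1 rmorph1.
  - by rewrite rmorphD /= -!phitE chiD.
  by rewrite -skew_mul_map; [rewrite -!phitE chiM | apply: tofrac_inj].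
have phit_pull a : phit (pull pi a) = phi a.
  by apply: map_inj; rewrite -phitE chi_pull.
have [_ phitD phitM] := phit_skew.
(* The characteristic is the constant coefficient of the action. *)
pose ct0 a' := (phit a')`_0.
have ct0E a' : tofrac (ct0 a') = c' a' by rewrite -chi0 phitE coef_map.
have ctB : zmod_morphism ct0.
  by move=> x y; apply: tofrac_inj; rewrite ct0E !rmorphB /= !ct0E.
have ctM : monoid_morphism ct0.
  by split=> [|x y]; apply: tofrac_inj; rewrite ct0E ?rmorph1 ?rmorphM /= ?ct0E.
pose ct := HB.pack_for {rmorphism C' -> R} ct0
  (GRing.isZmodMorphism.Build _ _ ct0 ctB) (GRing.isMonoidMorphism.Build _ _ ct0 ctM).
have phit00 : phit 0 = 0 by apply: (addrI (phit 0)); rewrite -phitD !addr0.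
have size_phit a' : size (chi a') = size (phit a').
  by rewrite phitE size_map_inj_poly ?rmorph0 //; apply: tofrac_inj.
have phitP : drinfeld_coefs r' ct phit.
  split=> // [x|a' a'0].
    by apply: map_inj; rewrite -phitE chi_cst map_polyC /= ct0E.
  have [i [hi si _]] := chi_lead a' a'0; exists i; split=> //; rewrite -?size_phit //.
  (* phit(a') is a left factor of phi(a), whose leading coefficient is a unit of R. *)
  have [b' [a [a_neq0 ab]]] := covering_divides_pull pi a'0.
  have [_ _ /(_ a a_neq0)[l [_ sl ul]]] := phiP.
  have b'0 : b' != 0.
    apply: contra_eq_neq sl => b'0; rewrite -phit_pull -ab b'0 mulr0.
    by rewrite phit00 size_poly0.
  have [j [_ sj _]] := chi_lead b' b'0.
  rewrite size_phit in si; rewrite size_phit in sj.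
  by apply: (@skew_mul_unit_lead Fq _ _ _ _ _ l si sj); rewrite -phitM ab phit_pull.
pose Mt := additive_group k phit_skew.
have Mt_phit : presented Fq Mt phit := additive_group_presented k phit_skew.
exists ct; split=> //.
- by move=> a; apply: tofrac_inj; rewrite /= ct0E hc.
- by move=> ct2 h _ a'; apply: tofrac_inj; rewrite h /= ct0E.
exists Mt; split.
- exact: presented_drinfeld hR Mt_phit phitP.
- by apply: (presented_isomorphic (presented_base_change _ Mt_phit) M'_chi) => a'.
- exact: (presented_isomorphic (presented_push _ Mt_phit) M_phi).
move=> Mt2 hMt2 iso2 _.
have [phi2 Mt2_phi2 phi2P] := drinfeld_presented (valuation_ring_local hR) hMt2.
apply: (@presented_isomorphic Fq _ _ Mt2 Mt phit phit) => //.
(* Over K the isomorphism with M' gives [Mt2] a coordinate with action chi; it descends to one over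
   R with action phit. *)
apply: (presented_descent hR hr' phi2P phitP Mt2_phi2).
have [f fP] := isomorphic_presented iso2 M'_chi; exists f.
by have [fN fA f_bij] := fP; split=> // a' X x; rewrite fA phitE.
Qed.
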